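(* We have \[ \liminf_{n\to\infty}\frac{\log(s(n)/n)\,\log\log n}{\sqrt{\log n}}\geq\frac{\pi}{\sqrt3}. \] Equivalently, for every $\varepsilon>0$, \[ s(n)\geq n\exp\left(\left(\frac{\pi}{\sqrt3}-\varepsilon\right)\frac{\sqrt{\log n}}{\log\log n}\right) \] for all sufficiently large $n$. In particular, $s(n)=\Omega(n\log n)$, and $s(n)/n$ grows faster than every fixed power of $\log n$ (i.e. for every fixed $K>0$, $s(n)/(n(\log n)^K)\to\infty$ as $n\to\infty$).
   Context: $\log$ is the natural logarithm. For an integer $n\geq1$, $\mathcal{M}_n$ is the set (repeated values counted once) of all multinomial coefficient values $\frac{n!}{p_1!\cdots p_t!}$, where $(p_1,\ldots,p_t)$ ranges over all integer partitions of $n$ ($p_1\geq\cdots\geq p_t\geq1$, $p_1+\cdots+p_t=n$, $t\geq 1$ arbitrary). A finite set $S$ of integers is a Sidon set if $x+y=u+v$ with $x,y,u,v\in S$ implies that the unordered pairs (with repetition allowed) $\{x,y\}$ and $\{u,v\}$ coincide. $s(n)=\max\{|S|:S\subseteq\mathcal{M}_n,\ S\text{ is Sidon}\}$. *)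

(* Defs.v *)
From mathcomp Require Import all_boot all_order all_algebra finmap.
From mathcomp Require Import all_classical all_reals all_analysis.

Set Implicit Arguments.
Unset Strict Implicit.
Unset Printing Implicit Defensive.

Local Open Scope classical_set_scope.
Local Open Scope nat_scope.

Definition is_intpart (n : nat) (p : seq nat) : bool :=
  [&& sorted geq p, all (leq 1) p & sumn p == n].

Definition multinomial_values (n : nat) : set nat :=
  [set m | exists2 p, is_intpart n p & m = n`! %/ \prod_(i <- p) i`!].

(* The truncated division in [multinomial_values] is exact. *)
Lemma dvdn_multinomial (n : nat) (p : seq nat) :
  is_intpart n p -> \prod_(i <- p) i`! %| n`!.
Proof.
case/and3P=> _ _ /eqP <-.
elim: p => [|a p IHp] /=; first by rewrite big_nil.
rewrite big_cons -(bin_fact (leq_addr (sumn p) a)) addKn.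
by apply: dvdn_mull; apply: dvdn_mul.
Qed.

(* [fset_set A] is the empty set when [A] is infinite; this lemma rules that
   out in the definition of [max_sidon]. *)
Lemma finite_multinomial_values (n : nat) : finite_set (multinomial_values n).
Proof.
apply: (sub_finite_set _ (finite_II n`!.+1)) => m [p _ ->] /=.
by rewrite ltnS leq_div.
Qed.

Definition sidon (S : {fset nat}) : Prop :=
  forall x y u v : nat, x \in S -> y \in S -> u \in S -> v \in S ->
    x + y = u + v -> (x = u /\ y = v) \/ (x = v /\ y = u).

Definition max_sidon (n : nat) : nat :=
  \max_(S <- fpowerset (fset_set (multinomial_values n)) | `[< sidon S >])
    #|` S|.

(* Main.v *)
(* A greedy argument extracts from any finite set A of naturals a Sidon set of
   size at least (|A| / 2)^(1/3), so a polynomial lower bound of high degree on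
   the number of multinomial values is enough.  Partitions of n with parts among
   1, 2, 3, 5, 7, 11, 13, each prime part having multiplicity < n / 41
   (41 = 2 + 3 + 5 + 7 + 11 + 13), give (n / 41)^6 values: they are distinct
   because the multiplicity of a prime part p is the p-adic valuation of the
   product of the factorials of the parts at most p.  Hence s(n) >= c n^2, which
   dominates n exp(A sqrt(log n)) for every constant A. *)
Require Import Defs.
From mathcomp Require Import all_boot all_order all_algebra finmap.
From mathcomp Require Import all_classical all_reals all_analysis.
From mathcomp Require Import zify lra.
Import Order.TTheory GRing.Theory Num.Theory.
Import numFieldNormedType.Exports.
Local Open Scope classical_set_scope.
Local Open Scope ring_scope.

(** * Greedy construction of Sidon sets *)

(** A new element x can break the Sidon property only through x + y = u + v or x + x = u + v with u,
    v, y in [S]. These equations exclude at most |S|^3 + |S|^2 <= 2 |S|^3 values of x. *)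
Lemma sidon_extend (A S : {fset nat}) :
  (S `<=` A)%fset -> sidon S -> (2 * #|` S| ^ 3 < #|` A|)%N ->
  exists x, [/\ x \in A, x \notin S & sidon (x |` S)%fset].
Proof.
move=> SA sS ltA.
pose sums := [seq (u + v)%N | u <- S, v <- S].
(* Taking y = v, the values u + v - y also cover S itself. *)
pose B := [seq (w - y)%N | w <- sums, y <- S] ++ [seq w./2 | w <- sums].
have cB : (size B <= 2 * #|` S| ^ 3)%N.
  rewrite size_cat size_map !size_allpairs mul2n -addnn !expnSr expn0 mul1n.
  by rewrite leq_add2l; case: #|` S| => // k; rewrite leq_pmulr.
have [x xA xB] : exists2 x, x \in A & x \notin B.
  apply/allPn; apply: contraL ltA => /allP AB.
  by rewrite -leqNgt (leq_trans _ cB) // uniq_leq_size.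
move: xB; rewrite mem_cat negb_or => /andP[x1 x2].
have n1 u v y : u \in S -> v \in S -> y \in S -> x <> (u + v - y)%N.
  move=> uS vS yS e; move/negP: x1; apply.
  by rewrite e; apply: allpairs_f => //; apply: allpairs_f.
have n2 u v : u \in S -> v \in S -> (x + x)%N <> (u + v)%N.
  move=> uS vS e; move/negP: x2; apply; apply/mapP.
  by exists (u + v)%N; [apply: allpairs_f | rewrite -e addnn doubleK].
exists x; split=> //.
  by apply/negP => xS; apply: (n1 x x x) => //; rewrite addnK.
move=> a b c d /fset1UP ha /fset1UP hb /fset1UP hc /fset1UP hd e.
case: ha hb hc hd => [ha|ha] [hb|hb] [hc|hc] [hd|hd];
  try (have := n1 _ _ _ hc hd hb); try (have := n1 _ _ _ hc hd ha);
  try (have := n1 _ _ _ ha hb hc); try (have := n1 _ _ _ ha hb hd);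
  try (have := n2 _ _ hc hd); try (have := n2 _ _ ha hb);
  try (have := sS _ _ _ _ ha hb hc hd e); lia.
Qed.

(** Starting from the empty set, the last extension goes from size [j] to [j.+1]; its size condition
    implies those of all earlier extensions. *)
Lemma sidon_greedy (A : {fset nat}) (j : nat) :
  (2 * j ^ 3 < #|` A|)%N ->
  exists S : {fset nat}, [/\ (S `<=` A)%fset, sidon S & #|` S| = j.+1].
Proof.
have grow S : (S `<=` A)%fset -> sidon S -> (2 * #|` S| ^ 3 < #|` A|)%N ->
    exists T : {fset nat}, [/\ (T `<=` A)%fset, sidon T & #|` T| = (#|` S|).+1].
  move=> SA sS /(sidon_extend A S SA sS)[x [xA xS sx]].
  by exists (x |` S)%fset; rewrite fsubUset fsub1set xA SA cardfsU1 xS.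
elim: j => [|j IHj] ltA.
  rewrite -(cardfs0 nat); apply: grow; [exact: fsub0set | | ].
    by move=> x y u v; rewrite inE.
  by rewrite cardfs0.
have /IHj [S [SA sS cS]] : (2 * j ^ 3 < #|` A|)%N.
  by apply: leq_ltn_trans ltA; rewrite leq_pmul2l // leq_exp2r.
by have := grow S SA sS; rewrite cS; apply.
Qed.

Lemma card_multinomial_values_le (n : nat) :
  (#|` fset_set (multinomial_values n)| <= 2 * max_sidon n ^ 3)%N.
Proof.
(* Taking [j := max_sidon n], failure of the bound would yield a Sidon set one larger than the
   maximum. *)
rewrite leqNgt; apply/negP => /sidon_greedy[S [SA sS cS]].
suff : (#|` S| <= max_sidon n)%N by rewrite cS ltnn.
by apply: leq_bigmax_seq; [rewrite fpowersetE | apply/asboolP].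
Qed.

(** * Counting multinomial values by p-adic valuations *)

Lemma logn_prod_fact_lt (p : nat) (q : seq nat) :
  prime p -> all (gtn p) q -> logn p (\prod_(i <- q) i`!) = 0%N.
Proof.
move=> pp; elim: q => [|i q IHq] /=; first by rewrite big_nil logn1.
case/andP=> ip qp; rewrite big_cons lognM ?fact_gt0 ?prodn_gt0 //; last first.
  by move=> j; rewrite fact_gt0.
(* In Legendre's formula every term [i %/ p ^ k] vanishes, as i < p <= p^k. *)
rewrite IHq // addn0 logn_fact // big_nat_cond big1 // => k /andP[/andP[k0 _] _].
by rewrite divn_small // (leq_trans ip) // -{1}(expn1 p) leq_exp2l // prime_gt1.
Qed.

Lemma logn_fact_prime (p : nat) : prime p -> logn p p`! = 1%N.
Proof.
move=> pp; case: p pp => // p pp; rewrite factS lognM ?fact_gt0 //.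
have := logn_prod_fact_lt p.+1 [:: p] pp; rewrite big_seq1 /= ltnSn => -> //.
by rewrite logn_prime // eqxx.
Qed.

(** The list decreases, so its head p exceeds all later primes and does not divide the products d
    built from them. The valuation of p!^a * d at p is then a, which recovers a and hence d; each
    prime contributes the m choices a < m. *)
Lemma distinct_fact_products (m : nat) (ps : seq nat) :
  sorted gtn ps -> all prime ps ->
  exists D : seq nat, [/\ uniq D, size D = (m ^ size ps)%N &
    forall d, d \in D -> exists q,
      [/\ {subset q <= ps}, (sumn q <= m * sumn ps)%N &
        d = (\prod_(i <- q) i`!)%N]].
Proof.
elim: ps => [|p ps IHps] /=.
  exists [:: 1%N]; split=> // d; rewrite inE => /eqP->.
  by exists [::]; rewrite big_nil.
rewrite path_sortedE; last by move=> x y z; rewrite /gtn /=; lia.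
move=> /andP[psp sps] /andP[pp prps].
have [D [uD sD HD]] := IHps sps prps.
have Dp d : d \in D -> (0 < d)%N /\ logn p d = 0%N.
  move=> /HD[q [qps _ ->]]; split.
    by rewrite prodn_gt0 // => j; rewrite fact_gt0.
  by apply: logn_prod_fact_lt => //; apply/allP => i /qps /(allP psp).
exists [seq (p`! ^ a * d)%N | a <- iota 0 m, d <- D]; split.
- apply: allpairs_uniq => //; first exact: iota_uniq.
  move=> _ _ /allpairsP[[a d] /= [_ dD ->]] /allpairsP[[b e] /= [_ eD ->]] /= E.
  have [d0 ld] := Dp _ dD; have [e0 le] := Dp _ eD.
  have := congr1 (logn p) E.
  rewrite !lognM ?expn_gt0 ?fact_gt0 // !lognX logn_fact_prime // ld le.
  rewrite !addn0 !muln1 => ab; move: E; rewrite ab => /eqP.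
  by rewrite eqn_pmul2l ?expn_gt0 ?fact_gt0 // => /eqP->.
- by rewrite size_allpairs size_iota sD expnS.
- move=> _ /allpairsP[[a d] /= [am /HD[q [qps sq ->]] ->]].
  rewrite mem_iota add0n in am; exists (nseq a p ++ q); split.
  + move=> i; rewrite mem_cat mem_nseq => /orP[/andP[_ /eqP->]|/qps i_ps].
      by rewrite mem_head.
    by rewrite inE i_ps orbT.
  + by rewrite sumn_cat sumn_nseq; nia.
  + by rewrite big_cat big_nseq_cond /= iter_muln muln1.
Qed.

Lemma card_multinomial_values_ge (n m : nat) (ps : seq nat) :
  sorted gtn ps -> all prime ps -> (m * sumn ps <= n)%N ->
  (m ^ size ps <= #|` fset_set (multinomial_values n)|)%N.
Proof.
move=> sps prps len; have [D [uD <- HD]] := distinct_fact_products m ps sps prps.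
have part d : d \in D -> exists2 p, is_intpart n p & d = (\prod_(i <- p) i`!)%N.
  (* Padding with parts 1 brings the sum up to n and keeps the product, since 1! = 1. *)
  move=> /HD[q [qps sq ->]]; pose p := sort geq (q ++ nseq (n - sumn q) 1%N).
  have pp : perm_eq p (q ++ nseq (n - sumn q) 1%N) by rewrite perm_sort.
  exists p; last first.
    rewrite (perm_big _ pp) big_cat big_nseq_cond /= iter_muln.
    by rewrite exp1n !muln1.
  apply/and3P; split.
  - by apply: sort_sorted => x y; rewrite /geq /= leq_total.
  - rewrite (perm_all _ pp) all_cat all_nseq orbT andbT.
    by apply/allP => i /qps /(allP prps) /prime_gt0.
  - by rewrite (perm_sumn pp) sumn_cat sumn_nseq; apply/eqP; lia.
have dvdD d : d \in D -> (d %| n`!)%N.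
  by move=> /part[p ip ->]; exact: dvdn_multinomial.
(* Dividing n! is injective on divisors of n!, so distinct products give distinct multinomial
   values. *)
rewrite -(size_map (fun d => n`! %/ d)%N); apply: uniq_leq_size.
  rewrite map_inj_in_uniq // => d e /dvdD dd /dvdD de E.
  have := divnK dd; rewrite E -[in RHS](divnK de) => /eqP.
  rewrite eqn_pmul2l => [/eqP//|].
  have e0 : (0 < e)%N by apply: dvdn_gt0 de; exact: fact_gt0.
  by rewrite divn_gt0 // dvdn_leq // fact_gt0.
move=> _ /mapP[d /part[p ip ->] ->].
rewrite -[_ \in _]/(_ \in fset_set (multinomial_values n)).
rewrite in_fset_set; last exact: finite_multinomial_values.
by apply/mem_set; exists p.
Qed.

Lemma max_sidon_ge_square (n : nat) :
  (41 <= n -> n ^ 2 <= 82 ^ 2 * (2 * max_sidon n))%N.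
Proof.
move=> n41; pose m := (n %/ 41)%N.
have cM : (m ^ 6 <= #|` fset_set (multinomial_values n)|)%N.
  apply: (card_multinomial_values_ge n m [:: 13; 11; 7; 5; 3; 2]%N) => //.
  exact: leq_divM.
(* Six primes give a sixth power, hence a square after the cube root; 2 is weakened to 2^3 to make
   the right side a cube. *)
have : ((m ^ 2) ^ 3 <= (2 * max_sidon n) ^ 3)%N.
  rewrite -expnM; apply: (leq_trans cM).
  apply: (leq_trans (card_multinomial_values_le n)).
  by rewrite expnMn leq_mul2r orbT.
rewrite leq_exp2r // => ms.
(* Here m >= 1, so n < 41 (m + 1) <= 82 m. *)
have nm : (n <= 82 * m)%N by rewrite /m; lia.
rewrite -(leq_exp2r _ _ (isT : 0 < 2)%N) expnMn in nm.
by apply: (leq_trans nm); rewrite leq_pmul2l // expn_gt0.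
Qed.

(** * Asymptotic comparisons in terms of sqrt (log n) *)

Lemma near_sqrt_ln_ge (R : realType) (M : R) :
  \forall n \near \oo, M <= Num.sqrt (ln n%:R).
Proof.
near=> n; have nM : expR (M ^+ 2) <= n%:R by near: n; exact: nbhs_infty_ger.
have n0 : 0 < n%:R :> R by apply: lt_le_trans nM; exact: expR_gt0.
apply: (le_trans (ler_norm M)); rewrite -sqrtr_sqr ler_wsqrtr //.
by rewrite -ler_expR lnK // posrE.
Unshelve. all: by end_near. Qed.

(** With t = sqrt (log n), n is exp (t^2), so the quadratic bound n^2 <= c s(n) reduces the claim to
    A t + log c <= t^2. This holds once t >= 1 and t >= |A| + |log c|. *)
Lemma near_max_sidon_ge_exp (R : realType) (A : R) :
  \forall n \near \oo,
    n%:R * expR (A * Num.sqrt (ln n%:R)) <= (max_sidon n)%:R.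
Proof.
have [c c0 Hc] : exists2 c : R,
    0 < c & forall n, (41 <= n)%N -> n%:R ^+ 2 <= c * (max_sidon n)%:R.
  exists ((82 ^ 2)%:R * 2); first by rewrite mulr_gt0 // ltr0n expn_gt0.
  move=> n /max_sidon_ge_square.
  by rewrite -(ler_nat R) natrX natrM natrM mulrA.
near=> n; set t := Num.sqrt _.
have n0 : 0 < n%:R :> R.
  by rewrite ltr0n (@leq_trans 41) //; near: n; exact: nbhs_infty_ge.
have t1 : 1 <= t by rewrite /t; near: n; exact: near_sqrt_ln_ge.
have tA : `|A| + `|ln c| <= t by rewrite /t; near: n; exact: near_sqrt_ln_ge.
have lnE : ln n%:R = t ^+ 2.
  rewrite sqr_sqrtr //; apply: ltW; rewrite -sqrtr_gt0 -/t.
  by apply: lt_le_trans t1.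
have le_t2 : A * t + ln c <= t ^+ 2.
  have := ler_norm A; have := ler_norm (ln c); have := normr_ge0 (ln c); nra.
rewrite -(ler_pM2l c0).
apply: le_trans (Hc n _); last by near: n; exact: nbhs_infty_ge.
rewrite mulrCA expr2 ler_pM2l // -[X in X * _](@lnK _ c) ?posrE //.
rewrite -[leRHS](@lnK _ n%:R) ?posrE // -expRD ler_expR lnE; lra.
Unshelve. all: by end_near. Qed.

(** Once sqrt (log n) >= e, also log n >= e, because t^2 >= t for t >= 1. *)
Lemma near_lnln_ge1 (R : realType) :
  \forall n \near \oo, 1 <= ln (ln n%:R) :> R.
Proof.
near=> n.
have ee : expR 1 <= Num.sqrt (ln n%:R) :> R by near: n; exact: near_sqrt_ln_ge.
have e0 := expR_gt0 (1 : R); have e1 := expR_ge1Dx (1 : R).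
have l0 : 0 < ln n%:R :> R by rewrite -sqrtr_gt0; exact: lt_le_trans ee.
rewrite -ler_expR lnK ?posrE //; apply: (le_trans ee).
rewrite -[leRHS]sqr_sqrtr ?ltW //; nra.
Unshelve. all: by end_near. Qed.

(** Squaring sqrt x <= exp (sqrt x) gives this. It lets exp (A sqrt (log n)) absorb powers of log
    n. *)
Lemma le_expR_sqrt (R : realType) (x : R) : 0 <= x -> x <= expR (2 * Num.sqrt x).
Proof.
move=> x0; rewrite -[leLHS]sqr_sqrtr // expRM_natl.
apply: lerXn2r; rewrite ?nnegrE ?sqrtr_ge0 ?expR_ge0 //.
by have := expR_ge1Dx (Num.sqrt x); lra.
Qed.

Theorem theorem1p1 (R : realType) :
  [/\ ((pi / Num.sqrt 3 : R)%:E <=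
        limn_einf (fun n : nat =>
          (ln ((max_sidon n)%:R / n%:R) * ln (ln n%:R) /
             Num.sqrt (ln n%:R) : R)%:E))%E,
      forall eps : R, 0 < eps ->
        \forall n \near \oo,
          n%:R * expR ((pi / Num.sqrt 3 - eps) *
                       (Num.sqrt (ln n%:R) / ln (ln n%:R)))
            <= (max_sidon n)%:R,
      (fun n : nat => (max_sidon n)%:R : R^o) \is
        'Omega_\oo (fun n : nat => n%:R * ln n%:R : R^o)
    & forall K : R, 0 < K ->
        (fun n : nat => (max_sidon n)%:R / (n%:R * (ln n%:R `^ K)) : R)
          @ \oo --> +oo].
Proof.
have near_n_gt0 : \forall n \near \oo, 0 < n%:R :> R.
  by near=> n; rewrite ltr0n; near: n; exact: nbhs_infty_ge.
have near_ln_gt0 : \forall n \near \oo, 0 < ln n%:R :> R.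
  near=> n; rewrite -sqrtr_gt0; apply: (@lt_le_trans _ _ 1) => //.
  by near: n; exact: near_sqrt_ln_ge.
split.
- rewrite limn_einf_lim; apply: lime_ge; first exact: is_cvg_einfs.
  suff [m _ Hm] : \forall n \near \oo, pi / Num.sqrt 3 <=
      ln ((max_sidon n)%:R / n%:R) * ln (ln n%:R) / Num.sqrt (ln n%:R) :> R.
    exists m => // k /= mk; apply: le_ereal_inf_tmp => _ [p /= kp <-].
    by rewrite lee_fin; apply: Hm => /=; exact: leq_trans kp.
  near=> n; set C := pi / Num.sqrt 3; set t := Num.sqrt (ln n%:R).
  have C0 : 0 <= C by rewrite divr_ge0 ?pi_ge0 ?sqrtr_ge0.
  have n0 : 0 < n%:R :> R by near: n.
  have t0 : 0 < t by rewrite sqrtr_gt0; near: n.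
  have ll1 : 1 <= ln (ln n%:R) :> R by near: n; exact: near_lnln_ge1.
  have : n%:R * expR (C * t) <= (max_sidon n)%:R.
    by rewrite /C /t; near: n; exact: near_max_sidon_ge_exp.
  rewrite mulrC -ler_pdivlMr // => sn.
  have Ct : C * t <= ln ((max_sidon n)%:R / n%:R).
    rewrite -ler_expR lnK // posrE; apply: lt_le_trans sn; exact: expR_gt0.
  (* The logarithm is at least C t >= 0, so the factor log log n >= 1 can only increase it. *)
  rewrite ler_pdivlMr //; apply: (le_trans Ct); apply: ler_peMr => //.
  by apply: le_trans Ct; rewrite mulr_ge0 // ltW.
- move=> eps _; set C := _ - eps; near=> n.
  have n0 : 0 < n%:R :> R by near: n.
  have ll1 : 1 <= ln (ln n%:R) :> R by near: n; exact: near_lnln_ge1.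
  (* The absolute value covers large [eps], for which [C] is negative. *)
  have sn : n%:R * expR (`|C| * Num.sqrt (ln n%:R)) <= (max_sidon n)%:R.
    by near: n; exact: near_max_sidon_ge_exp.
  apply: le_trans sn; rewrite ler_pM2l // ler_expR.
  have d0 : 0 <= Num.sqrt (ln n%:R) / ln (ln n%:R) :> R.
    by rewrite divr_ge0 ?sqrtr_ge0 // (le_trans _ ll1).
  apply: (@le_trans _ _ (`|C| * (Num.sqrt (ln n%:R) / ln (ln n%:R)))).
    by rewrite ler_wpM2r // ler_norm.
  rewrite ler_wpM2l // ler_pdivrMr ?(lt_le_trans _ ll1) //.
  by rewrite ler_peMr ?sqrtr_ge0.
- rewrite qualifE; apply/asboolP; exists 1 => //; near=> n.
  have n0 : 0 < n%:R :> R by near: n.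
  have l0 : 0 < ln n%:R :> R by near: n.
  rewrite mul1r !ger0_norm //; last by rewrite mulr_ge0 // ltW.
  have sn : n%:R * expR (2 * Num.sqrt (ln n%:R)) <= (max_sidon n)%:R :> R.
    by near: n; exact: near_max_sidon_ge_exp.
  by apply: le_trans sn; rewrite ler_pM2l // le_expR_sqrt // ltW.
- move=> K K0; apply/cvgryPge => M; near=> n.
  have n0 : 0 < n%:R :> R by near: n.
  have l0 : 0 < ln n%:R :> R by near: n.
  pose t : R := Num.sqrt (ln n%:R).
  have tM : M <= t by rewrite /t; near: n; exact: near_sqrt_ln_ge.
  (* In the exponent, 2 K t pays for (log n)^K, and the remaining factor exp t >= t >= M gives
     divergence. *)
  have sn : n%:R * expR ((1 + K * 2) * t) <= (max_sidon n)%:R.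
    by rewrite /t; near: n; exact: near_max_sidon_ge_exp.
  have lK : ln n%:R `^ K <= expR (K * (2 * t)).
    rewrite /powR gt_eqF // ler_expR ler_pM2l // -ler_expR lnK ?posrE //.
    by rewrite le_expR_sqrt // ltW.
  rewrite ler_pdivlMr; last by rewrite mulr_gt0 // powR_gt0.
  apply: le_trans sn; rewrite mulrCA ler_pM2l //.
  rewrite mulrDl mul1r expRD -mulrA.
  apply: (@le_trans _ _ (expR t * (ln n%:R `^ K))).
    by rewrite ler_wpM2r ?powR_ge0 //; have := expR_ge1Dx t; lra.
  by rewrite ler_wpM2l ?expR_ge0.
Unshelve. all: by end_near. Qed.
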